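(* The function $g$ from the non-negative integers to the non-negative integers is injective.
   Context: For a non-negative integer $n$, $g(n)$ is the least integer $k$ such that there exists a strictly increasing sequence of integers $n = a_1 < a_2 < \cdots < a_t = k$ ($t \geq 1$) whose product $a_1 a_2 \cdots a_t$ is a perfect square. *)

(* Defs.v *)
(* MathComp, with the classical layer of MathComp-Analysis used only for the
   boolean reflection `[< P >] of a proposition P. *)
From mathcomp Require Import all_boot boolp.

Set Implicit Arguments.
Unset Strict Implicit.
Unset Printing Implicit Defensive.

Definition perfect_square (m : nat) : Prop := exists r : nat, m = r ^ 2.

(* The sequence a_1 < ... < a_t is n :: s, so that t >= 1 and a_1 = n are
   built in. As a_1 = n >= 0, all its terms are non-negative integers. *)
Definition square_chain (n k : nat) : Prop :=
  exists s : seq nat,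
    [/\ sorted ltn (n :: s), last n s = k
      & perfect_square (\prod_(a <- n :: s) a)].

Lemma square_chain_ex (n : nat) : exists k, `[< square_chain n k >].
Proof.
case: n => [|n].
  exists 0; apply/asboolP; exists [::]; split => //.
  by exists 0; rewrite big_seq1.
exists (4 * n.+1); apply/asboolP; exists [:: 4 * n.+1]; split => //.
  by rewrite /= andbT ltn_Pmull.
exists (2 * n.+1); rewrite big_cons big_seq1.
by rewrite expnMn mulnCA.
Qed.

Definition g (n : nat) : nat := ex_minn (square_chain_ex n).

(* Main.v *)
(* If g m = g n = k with m < n, take optimal sequences for m and for n, both
   ending in k. The product over the symmetric difference of their sets of terms
   is the product of the two squares divided by the square of the product over
   the common terms, hence a square. That set has least element m and does not
   contain k, so it gives a sequence for m with a last term below k,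
   contradicting the minimality of g m. *)
Require Import Defs.
From mathcomp Require Import all_boot boolp.

Lemma g_chain n : square_chain n (g n).
Proof. by rewrite /g; case: ex_minnP => k /asboolP. Qed.

Lemma g_min n k : square_chain n k -> g n <= k.
Proof. by rewrite /g; case: ex_minnP => j _ + /asboolP; apply. Qed.

Lemma sorted_ltn_head_last n s x :
  sorted ltn (n :: s) -> x \in n :: s -> n <= x <= last n s.
Proof.
elim: s n x => [|a s IH] n x /=; first by rewrite inE => _ /eqP->; rewrite leqnn.
case/andP=> na pas; rewrite inE => /predU1P[->|xs].
  have /andP[_ al] := IH a a pas (mem_head a s).
  by rewrite leqnn (leq_trans (ltnW na) al).
by have /andP[ax ->] := IH a x pas xs; rewrite (leq_trans (ltnW na) ax).
Qed.

(** A strictly increasing list is determined by its members. This lets two chains be compared as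
    predicates over one common range. *)
Lemma prod_sorted_ltn (s : seq nat) m N :
  sorted ltn s -> {in s, forall x, m <= x < N} ->
  \prod_(a <- s) a = \prod_(m <= i < N | i \in s) i.
Proof.
move=> s_sorted s_in; rewrite -[RHS]big_filter.
congr bigop.
apply: (irr_sorted_eq ltn_trans ltnn s_sorted) => [|x].
  exact: (sorted_filter ltn_trans _ (iota_ltn_sorted _ _)).
rewrite mem_filter mem_index_iota.
by case: (boolP (x \in s)) => //= /s_in.
Qed.

(** Factor by factor: an [i] in both [P] and [Q] contributes [i * i] to each side, an [i] in exactly
    one contributes [i]. *)
Lemma prod_symdiff (r : seq nat) (P Q : pred nat) :
  \prod_(i <- r | P i (+) Q i) i * (\prod_(i <- r | P i && Q i) i) ^ 2 =
  \prod_(i <- r | P i) i * \prod_(i <- r | Q i) i.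
Proof.
rewrite -mulnn (big_mkcond (fun i => P i (+) Q i)) (big_mkcond (fun i => P i && Q i)).
rewrite (big_mkcond P) (big_mkcond Q) -!big_split /=.
by apply: eq_bigr => i _; case: (P i); case: (Q i); rewrite ?muln1 ?mul1n.
Qed.

Lemma perfect_squareM a b :
  perfect_square a -> perfect_square b -> perfect_square (a * b).
Proof. by move=> [x ->] [y ->]; exists (x * y); rewrite expnMn. Qed.

Lemma perfect_square_cancel a b :
  0 < b -> perfect_square (a * b ^ 2) -> perfect_square a.
Proof.
move=> b_gt0 [c ac].
have /dvdnP[q cq] : b %| c by rewrite -(@dvdn_pexp2r _ _ 2) // -ac dvdn_mull.
exists q; apply/eqP; rewrite -(@eqn_pmul2r (b ^ 2)) ?expn_gt0 ?b_gt0 //.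
by rewrite ac cq expnMn.
Qed.

Lemma square_chain_symdiff m n k :
  0 < m < n -> square_chain m k -> square_chain n k ->
  exists2 j, j < k & square_chain m j.
Proof.
case/andP=> m_gt0 mn [s [s_sorted s_last s_sq]] [t [t_sorted t_last t_sq]].
have s_in x : x \in m :: s -> m <= x < k.+1.
  by move/(sorted_ltn_head_last _ _ _ s_sorted); rewrite s_last ltnS.
have t_ge x : x \in n :: t -> n <= x <= k.
  by move/(sorted_ltn_head_last _ _ _ t_sorted); rewrite t_last.
have t_in x : x \in n :: t -> m <= x < k.+1.
  by case/t_ge/andP=> nx xk; rewrite ltnS xk (leq_trans (ltnW mn) nx).
have mk : m < k by have /andP[_ /(leq_trans mn)] := t_ge n (mem_head n t).
pose D := [pred i | (i \in m :: s) (+) (i \in n :: t)].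
have Dm : D m.
  rewrite /D /= mem_head; apply/negP => /t_ge /andP[nm _].
  by rewrite ltnNge nm in mn.
have Dk : D k = false.
  by rewrite /D /= -{1}s_last mem_last -t_last mem_last.
(* The new chain is [m :: u]: [m] survives since the terms of [n :: t] are at least [n > m], and
   [k], last in both chains, drops out. *)
pose u := filter D (iota m.+1 (k - m.+1)).
have uE : m :: u = filter D (index_iota m k).
  by rewrite /index_iota -(subnSK mk) /= [_ (+) _]Dm.
exists (last m u).
  have: last m u \in m :: u by exact: mem_last.
  by rewrite uE mem_filter mem_index_iota => /and3P[].
exists u; split=> //.
  rewrite uE; exact: (sorted_filter ltn_trans _ (iota_ltn_sorted _ _)).
rewrite uE big_filter.
(* Both old chains range up to [k] inclusive; adding index [k] is harmless because [D k] fails. *)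
have -> : \prod_(m <= i < k | D i) i = \prod_(m <= i < k.+1 | D i) i.
  by rewrite [RHS]big_mkcond big_nat_recr ?(ltnW mk) //= [_ (+) _]Dk muln1 -big_mkcond.
(* The common terms are at least [m > 0], so their product can be cancelled. *)
apply: (@perfect_square_cancel _
  (\prod_(m <= i < k.+1 | (i \in m :: s) && (i \in n :: t)) i)).
  rewrite big_seq_cond; apply: prodn_cond_gt0 => i.
  by rewrite mem_index_iota => /andP[/andP[mi _] _]; exact: leq_trans m_gt0 mi.
rewrite prod_symdiff -!prod_sorted_ltn //; exact: perfect_squareM.
Qed.

Lemma leq_g n : n <= g n.
Proof.
have [s [s_sorted <- _]] := g_chain n.
by have /andP[] := sorted_ltn_head_last _ _ _ s_sorted (mem_head n s).
Qed.

Lemma g0 : g 0 = 0.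
Proof.
apply/eqP; rewrite -leqn0; apply: g_min; exists [::]; split=> //.
by exists 0; rewrite big_seq1.
Qed.

Lemma g_neq m n : m < n -> g m <> g n.
Proof.
(* A chain from 0 has product 0, which blocks the cancellation; here [g 0 = 0 < n <= g n] settles
   the case. *)
case: m => [|m] mn gE.
  by have := leq_g n; rewrite -gE g0 leqNgt mn.
have gn := g_chain n; rewrite -gE in gn.
have [j jlt /g_min] := square_chain_symdiff m.+1 n _ mn (g_chain _) gn.
by rewrite leqNgt jlt.
Qed.

Theorem theorem1p8 : injective g.
Proof.
by move=> m n gE; case: (ltngtP m n) => // /g_neq; rewrite gE.
Qed.
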